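(* Let $q\in\mathbb{C}$ with $|q|<1$ and let $z\in\mathbb{C}$ with $z\notin\{0,e^{\pi i/3},e^{-\pi i/3}\}$ and $z\neq -q^{j}$ for every $j\in\mathbb{Z}\setminus\{0\}$. Then $$\sum_{n\geq 0}\frac{(z^{2};q)_n(z^{-2};q)_n\,q^n}{(-zq;q)_n(-z^{-1}q;q)_n}=(1-z)(1-z^{-1})\left[\frac{-1}{z(1-z^{-1}+z^{-2})}\cdot\frac{(z^{-2}q;q)_\infty(z^2q;q)_\infty}{(-z^{-1}q;q)_\infty(-zq;q)_\infty}\right]+\frac{1+z^{-1}}{z(1+z^{-3})},$$ where at $z=-1$ the last term is understood as its limiting value, i.e. $\frac{1+z^{-1}}{z(1+z^{-3})}$ is read as $\frac{1}{z(1-z^{-1}+z^{-2})}$.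
   Context: For $A\in\mathbb{C}$ and $|q|<1$: $(A;q)_n=\prod_{j=1}^{n}(1-Aq^{j-1})$ for integers $n\ge 0$ (so $(A;q)_0=1$), and $(A;q)_\infty=\lim_{n\to\infty}(A;q)_n$. *)

(* Defs.v *)
From Stdlib Require Import Reals ZArith.
From Coquelicot Require Import Coquelicot.
Open Scope C_scope.

Fixpoint qPoch (A q : C) (n : nat) : C :=
  match n with
  | O => 1
  | S m => qPoch A q m * (1 - A * q ^ m)
  end.

(* [lim] is total: it is the limit of the partial products when these converge,
   which is always the case for [Cmod q < 1]. *)
Definition qPoch_inf (A q : C) : C :=
  @lim C_CompleteNormedModule (filtermap (qPoch A q) eventually).

(* Since [/ 0 = 0], a negative power of [0] is [0]. *)
Definition Cpowz (q : C) (j : Z) : C :=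
  match j with
  | Z0 => 1
  | Zpos p => q ^ Pos.to_nat p
  | Zneg p => / q ^ Pos.to_nat p
  end.

Definition Cexp (w : C) : C :=
  (exp (Re w) * cos (Im w), exp (Re w) * sin (Im w))%R.

(* [(1 + z^-1) / (z (1 + z^-3))], continued to its removable singularity
   at [z = -1]. *)
Definition last_term (z : C) : C :=
  if Ceq_dec z (- (1)) then 1 / (z * (1 - / z + / z ^ 2))
  else (1 + / z) / (z * (1 + / z ^ 3)).

(* Main.v *)
Require Import Defs.
From Stdlib Require Import Reals ZArith Lra.
From Coquelicot Require Import Coquelicot.
Open Scope C_scope.

(* The series telescopes: with [w = z + 1/z], the sum of its first [N + 1] terms times [w - 1] is
   [1 - (1-z)(1-1/z) (z^2 q)_N (z^-2 q)_N / ((-zq)_N (-q/z)_N)].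
   The passage to the limit needs that the infinite products converge and that
   those in the denominator do not vanish. *)

(** * Limits of complex sequences *)

Lemma Cmod_lt_locally (l : C) (eps : posreal) :
  locally (l : C_NormedModule) (fun x : C => (Cmod (x - l) < eps)%R).
Proof.
  apply (locally_le_locally_norm (V := C_NormedModule) l).
  exists eps. intros y Hy. exact Hy.
Qed.

(** Reduces complex limits to real null sequences, where the real limit laws apply. Both directions
    rest on norm balls and uniform balls generating the same neighbourhoods. *)
Lemma filterlim_C_Cmod (u : nat -> C) (l : C) :
  filterlim u eventually (locally (l : C_NormedModule)) <->
  is_lim_seq (fun n => Cmod (u n - l)) 0.
Proof.
  split.
  - intros H. apply is_lim_seq_spec. intros eps.
    apply (filter_imp (fun n => Cmod (u n - l) < eps)%R).
    { intros n Hn. rewrite Rminus_0_r, Rabs_pos_eq by apply Cmod_ge_0. exact Hn. }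
    exact (H _ (Cmod_lt_locally l eps)).
  - intros H P HP.
    apply (locally_norm_le_locally (V := C_NormedModule) l) in HP.
    destruct HP as [eps HP].
    apply is_lim_seq_spec in H. specialize (H eps).
    unfold filtermap. revert H. apply filter_imp. intros n Hn.
    apply HP. rewrite Rminus_0_r, Rabs_pos_eq in Hn by apply Cmod_ge_0. exact Hn.
Qed.

Lemma filterlim_Cplus (u v : nat -> C) (a b : C) :
  filterlim u eventually (locally (a : C_NormedModule)) ->
  filterlim v eventually (locally (b : C_NormedModule)) ->
  filterlim (fun n => u n + v n) eventually (locally (a + b : C_NormedModule)).
Proof.
  intros Hu Hv.
  exact (filterlim_comp_2 u v (plus (G := C_NormedModule)) Hu Hv
           (filterlim_plus (V := C_NormedModule) a b)).
Qed.

(** The product is read as the scalar action of C on itself. The scalar then lives in the uniform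
    structure of [C_AbsRing], and [locally_C] carries its neighbourhoods over. *)
Lemma filterlim_Cmult (u v : nat -> C) (a b : C) :
  filterlim u eventually (locally (a : C_NormedModule)) ->
  filterlim v eventually (locally (b : C_NormedModule)) ->
  filterlim (fun n => u n * v n) eventually (locally (a * b : C_NormedModule)).
Proof.
  intros Hu Hv.
  apply (filterlim_comp_2 (G := locally (a : AbsRing_UniformSpace C_AbsRing))
           (H := locally (b : C_NormedModule)) u v (scal (V := C_NormedModule))).
  - intros P HP. apply Hu, locally_C, HP.
  - exact Hv.
  - exact (filterlim_scal (V := C_NormedModule) a b).
Qed.

Lemma is_lim_seq_Cmod (u : nat -> C) (l : C) :
  filterlim u eventually (locally (l : C_NormedModule)) ->
  is_lim_seq (fun n => Cmod (u n)) (Cmod l).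
Proof.
  intros H. exact (filterlim_comp _ _ _ u _ _ _ _ H (filterlim_norm (V := C_NormedModule) l)).
Qed.

Lemma filterlim_Cinv (u : nat -> C) (l : C) :
  l <> 0 -> (forall n, u n <> 0) ->
  filterlim u eventually (locally (l : C_NormedModule)) ->
  filterlim (fun n => / u n) eventually (locally (/ l : C_NormedModule)).
Proof.
  intros Hl Hu H.
  assert (Hl' : Cmod l <> 0%R) by (apply Rgt_not_eq, Cmod_gt_0, Hl).
  apply filterlim_C_Cmod.
  apply is_lim_seq_ext with (fun n => Cmod (u n - l) / (Cmod (u n) * Cmod l))%R.
  - intros n.
    replace (/ u n - / l) with (- (u n - l) * / (u n * l)) by (field; auto).
    rewrite Cmod_mult, Cmod_opp, Cmod_inv by (apply Cmult_neq_0; auto).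
    rewrite Cmod_mult. reflexivity.
  - replace 0%R with (0 / (Cmod l * Cmod l))%R by (field; exact Hl').
    apply is_lim_seq_div'.
    + apply filterlim_C_Cmod, H.
    + apply is_lim_seq_mult'; [apply is_lim_seq_Cmod, H | apply is_lim_seq_const].
    + apply Rmult_integral_contrapositive; auto.
Qed.

(** * Upper bound and convergence for q-Pochhammer products *)

Lemma geometric_sum_bounds (r : R) (n : nat) :
  (0 <= r < 1 -> 0 <= (1 - r ^ n) / (1 - r) <= / (1 - r))%R.
Proof.
  intros [Hr0 Hr1].
  assert (0 < / (1 - r))%R by (apply Rinv_0_lt_compat; lra).
  assert (0 <= r ^ n)%R by (apply pow_le, Hr0).
  assert (r ^ n <= 1)%R by (rewrite <- (pow1 n); apply pow_incr; lra).
  unfold Rdiv. nra.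
Qed.

Lemma Cmod_qPoch_le (A q : C) (n : nat) :
  (Cmod q < 1)%R -> (Cmod (qPoch A q n) <= exp (Cmod A / (1 - Cmod q)))%R.
Proof.
  intros hq.
  assert (Hq0 := Cmod_ge_0 q). assert (HA := Cmod_ge_0 A).
  (* The induction needs the exact partial geometric sum in the exponent: each new factor has
     modulus at most [1 + Cmod A * Cmod q ^ n], hence at most the exponential of the new summand. *)
  apply Rle_trans with (exp (Cmod A * ((1 - Cmod q ^ n) / (1 - Cmod q)))).
  - induction n as [|n IH]; simpl.
    + rewrite Cmod_1.
      replace (Cmod A * ((1 - 1) / (1 - Cmod q)))%R with 0%R by (field; lra).
      rewrite exp_0. lra.
    + rewrite Cmod_mult.
      replace (Cmod A * ((1 - Cmod q * Cmod q ^ n) / (1 - Cmod q)))%R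
        with (Cmod A * ((1 - Cmod q ^ n) / (1 - Cmod q)) + Cmod A * Cmod q ^ n)%R
        by (field; lra).
      rewrite exp_plus.
      apply Rmult_le_compat; try apply Cmod_ge_0; [exact IH|].
      apply Rle_trans with (1 + Cmod A * Cmod q ^ n)%R; [|apply exp_ineq1_le].
      unfold Cminus. eapply Rle_trans; [apply Cmod_triangle|].
      rewrite Cmod_1, Cmod_opp, Cmod_mult, Cmod_pow. lra.
  - assert (H := geometric_sum_bounds (Cmod q) n (conj Hq0 hq)).
    assert (H2 : (Cmod A * ((1 - Cmod q ^ n) / (1 - Cmod q)) <= Cmod A / (1 - Cmod q))%R).
    { apply Rmult_le_compat_l; tauto. }
    destruct (Rle_lt_or_eq_dec _ _ H2) as [H3|H3].
    + apply Rlt_le, exp_increasing, H3.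
    + rewrite H3. lra.
Qed.

Lemma sum_n_telescope (u : nat -> C) (n : nat) :
  sum_n (fun k => u (S k) - u k) n = u (S n) - u O.
Proof.
  induction n as [|n IH].
  - apply sum_O.
  - rewrite sum_Sn, IH. change plus with Cplus.
    change (u (S n) - u O + (u (S (S n)) - u (S n)) = u (S (S n)) - u O). ring.
Qed.

(** Consecutive partial products differ by -(A;q)_n A q^n. The products being bounded, these
    differences are dominated by a geometric series, so they are summable. *)
Lemma qPoch_ex_lim (A q : C) :
  (Cmod q < 1)%R ->
  exists l : C, filterlim (qPoch A q) eventually (locally (l : C_NormedModule)).
Proof.
  intros hq. assert (Hq0 := Cmod_ge_0 q).
  destruct (ex_series_le (V := C_CompleteNormedModule)
    (fun n => qPoch A q (S n) - qPoch A q n)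
    (fun n => exp (Cmod A / (1 - Cmod q)) * Cmod A * Cmod q ^ n)%R) as [l Hl].
  - intros n. change norm with Cmod. simpl qPoch.
    replace (qPoch A q n * (1 - A * q ^ n) - qPoch A q n)
      with (- (qPoch A q n * (A * q ^ n))) by ring.
    rewrite Cmod_opp, !Cmod_mult, Cmod_pow, <- Rmult_assoc.
    apply Rmult_le_compat_r; [apply pow_le, Hq0|].
    apply Rmult_le_compat_r; [apply Cmod_ge_0|].
    apply Cmod_qPoch_le, hq.
  - apply (ex_series_scal (V := R_NormedModule)), ex_series_geom.
    rewrite Rabs_pos_eq; lra.
  (* The differences up to index n sum to (A;q)_{n+1} - (A;q)_0 with (A;q)_0 = 1, whence the added 1
     and the index shift. *)
  - exists (l + 1). apply filterlim_C_Cmod.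
    apply is_lim_seq_incr_1.
    apply is_lim_seq_ext with
      (fun n => Cmod (sum_n (fun n => qPoch A q (S n) - qPoch A q n) n - l)).
    + intros n. rewrite sum_n_telescope. apply (f_equal Cmod). simpl. ring.
    + apply filterlim_C_Cmod, Hl.
Qed.

(** [lim] is only specified on proper Cauchy filters; the existing limit [l] supplies the Cauchy
    property. *)
Lemma qPoch_inf_lim (A q : C) :
  (Cmod q < 1)%R ->
  filterlim (qPoch A q) eventually (locally (qPoch_inf A q : C_NormedModule)).
Proof.
  intros hq. destruct (qPoch_ex_lim A q hq) as [l Hl].
  apply filterlim_locally. intros eps.
  apply (complete_cauchy (T := C_CompleteNormedModule)
           (filtermap (qPoch A q) eventually)).
  - apply filtermap_proper_filter, eventually_filter.
  - intros e. exists l.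
    exact (proj1 (filterlim_locally (U := C_UniformSpace) (qPoch A q) l) Hl e).
Qed.

(** * Non-vanishing of the infinite products *)

Lemma qPoch_add (A q : C) (N n : nat) :
  qPoch A q (N + n) = qPoch A q N * qPoch (A * q ^ N) q n.
Proof.
  induction n as [|n IH].
  - rewrite Nat.add_0_r. simpl. ring.
  - rewrite Nat.add_succ_r. simpl. rewrite IH, Cpow_add_r. ring.
Qed.

(** Weierstrass product inequality: a product of factors 1 - x_j with x_j in [0,1] is at least 1
    minus the sum of the x_j. Here that sum is at most 1/2. *)
Lemma Cmod_qPoch_ge (A q : C) (n : nat) :
  (Cmod q < 1)%R -> (Cmod A <= (1 - Cmod q) / 2)%R -> (/ 2 <= Cmod (qPoch A q n))%R.
Proof.
  intros hq HAq.
  assert (Hq0 := Cmod_ge_0 q). assert (HA := Cmod_ge_0 A).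
  apply Rle_trans with (1 - Cmod A * ((1 - Cmod q ^ n) / (1 - Cmod q)))%R.
  - assert (H := geometric_sum_bounds (Cmod q) n (conj Hq0 hq)).
    assert (H2 : (Cmod A * ((1 - Cmod q ^ n) / (1 - Cmod q))
                  <= (1 - Cmod q) / 2 * / (1 - Cmod q))%R)
      by (apply Rmult_le_compat; tauto).
    replace ((1 - Cmod q) / 2 * / (1 - Cmod q))%R with (/ 2)%R in H2 by (field; lra).
    lra.
  - induction n as [|n IH]; simpl.
    + rewrite Cmod_1.
      replace (Cmod A * ((1 - 1) / (1 - Cmod q)))%R with 0%R by (field; lra). lra.
    + rewrite Cmod_mult.
      replace (Cmod A * ((1 - Cmod q * Cmod q ^ n) / (1 - Cmod q)))%R
        with (Cmod A * ((1 - Cmod q ^ n) / (1 - Cmod q)) + Cmod A * Cmod q ^ n)%R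
        by (field; lra).
      assert (Hs := proj1 (geometric_sum_bounds (Cmod q) n (conj Hq0 hq))).
      set (s := ((1 - Cmod q ^ n) / (1 - Cmod q))%R) in *.
      assert (Hp0 : (0 <= Cmod q ^ n)%R) by (apply pow_le, Hq0).
      assert (Hp1 : (Cmod q ^ n <= 1)%R) by (rewrite <- (pow1 n); apply pow_incr; lra).
      assert (Hx : (1 - Cmod A * Cmod q ^ n <= Cmod (1 - A * q ^ n))%R).
      { assert (H := Cmod_triangle (1 - A * q ^ n) (A * q ^ n)).
        replace (1 - A * q ^ n + A * q ^ n) with (RtoC 1) in H by ring.
        rewrite Cmod_1, Cmod_mult, Cmod_pow in H. lra. }
      set (p := (Cmod q ^ n)%R) in *.
      assert (0 <= Cmod A * p <= 1)%R by (split; nra).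
      apply Rle_trans with ((1 - Cmod A * s) * (1 - Cmod A * p))%R.
      * assert (0 <= Cmod A * s)%R by nra. nra.
      * apply Rle_trans with (Cmod (qPoch A q n) * (1 - Cmod A * p))%R.
        -- apply Rmult_le_compat_r; lra.
        -- apply Rmult_le_compat_l; [apply Cmod_ge_0 | exact Hx].
Qed.

Lemma qPoch_neq_0 (A q : C) (n : nat) :
  (forall k, 1 - A * q ^ k <> 0) -> qPoch A q n <> 0.
Proof.
  intros H. induction n as [|n IH]; simpl.
  - exact C1_nz.
  - apply Cmult_neq_0; auto.
Qed.

(** Split off N factors so that [A * q ^ N] is small. The head is a fixed nonzero number and every
    tail product has modulus at least 1/2, so the limit cannot be 0. *)
Lemma qPoch_inf_neq_0 (A q : C) :
  (Cmod q < 1)%R -> (forall k, 1 - A * q ^ k <> 0) -> qPoch_inf A q <> 0.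
Proof.
  intros hq H H0.
  assert (Hq0 := Cmod_ge_0 q). assert (HA := Cmod_ge_0 A).
  (* Dividing by [Cmod A + 1] instead of [Cmod A] covers A = 0 as well. *)
  destruct (pow_lt_1_zero (Cmod q)) with (y := ((1 - Cmod q) / 2 / (Cmod A + 1))%R)
    as [N HN].
  { rewrite Rabs_pos_eq; lra. }
  { apply Rdiv_lt_0_compat; lra. }
  specialize (HN N (Nat.le_refl N)).
  rewrite Rabs_pos_eq in HN by apply pow_le, Hq0.
  assert (Hsmall : (Cmod (A * q ^ N) <= (1 - Cmod q) / 2)%R).
  { rewrite Cmod_mult, Cmod_pow.
    apply Rmult_lt_compat_l with (r := (Cmod A + 1)%R) in HN; [|lra].
    replace ((Cmod A + 1) * ((1 - Cmod q) / 2 / (Cmod A + 1)))%R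
      with ((1 - Cmod q) / 2)%R in HN by (field; lra).
    assert (0 <= Cmod q ^ N)%R by apply pow_le, Hq0. lra. }
  assert (HNpos : (0 < Cmod (qPoch A q N))%R) by (apply Cmod_gt_0, qPoch_neq_0, H).
  assert (Hlim := is_lim_seq_Cmod _ _ (qPoch_inf_lim A q hq)).
  rewrite H0, Cmod_0 in Hlim.
  apply (is_lim_seq_incr_n _ N) in Hlim.
  assert (Hle : Rbar_le (Cmod (qPoch A q N) * / 2)%R 0).
  { eapply is_lim_seq_le; [|apply is_lim_seq_const|exact Hlim].
    intros n. cbv beta. rewrite Nat.add_comm, qPoch_add, Cmod_mult.
    apply Rmult_le_compat_l; [lra|]. apply Cmod_qPoch_ge; assumption. }
  simpl in Hle. lra.
Qed.

(** * The rational factors and the telescoped partial sum *)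

Lemma quadratic_neq_0 (z : C) :
  z <> Cexp (PI * Ci / 3) -> z <> Cexp (- (PI * Ci / 3)) -> z * z - z + 1 <> 0.
Proof.
  intros h1 h2 H.
  (* The two excluded points are (1 + i sqrt 3)/2 and (1 - i sqrt 3)/2, exactly the roots of the
     quadratic, which therefore factors over them. *)
  assert (E : PI * Ci / 3 = (0, (PI / 3)%R)).
  { replace (PI * Ci / 3) with (RtoC (PI / 3) * Ci).
    - unfold Ci, RtoC, Cmult. simpl. f_equal; ring.
    - rewrite RtoC_div by lra. field. }
  assert (E1 : Cexp (PI * Ci / 3) = ((1 / 2)%R, (sqrt 3 / 2)%R)).
  { rewrite E. unfold Cexp, Re, Im, fst, snd.
    rewrite exp_0, cos_PI3, sin_PI3, !Rmult_1_l. reflexivity. }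
  assert (E2 : Cexp (- (PI * Ci / 3)) = ((1 / 2)%R, (- (sqrt 3 / 2))%R)).
  { rewrite E. unfold Cexp, Copp, Re, Im, fst, snd.
    rewrite Ropp_0, exp_0, cos_neg, sin_neg, cos_PI3, sin_PI3, !Rmult_1_l. reflexivity. }
  rewrite E1 in h1. rewrite E2 in h2.
  assert (S3 : (RtoC (sqrt 3) * RtoC (sqrt 3) = 3)).
  { rewrite <- RtoC_mult, sqrt_sqrt by lra. reflexivity. }
  assert (F1 : ((1 / 2)%R, (sqrt 3 / 2)%R) = (1 + sqrt 3 * Ci) / 2).
  { unfold Ci, RtoC, Cdiv, Cinv, Cmult, Cplus. simpl. f_equal; field. }
  assert (F2 : ((1 / 2)%R, (- (sqrt 3 / 2))%R) = (1 - sqrt 3 * Ci) / 2).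
  { unfold Ci, RtoC, Cdiv, Cinv, Cmult, Cminus, Copp, Cplus. simpl. f_equal; field. }
  assert (I2 : Ci * Ci = - (1)).
  { unfold Ci, RtoC, Cmult, Copp. simpl. f_equal; ring. }
  rewrite F1 in h1. rewrite F2 in h2.
  assert (P : (z - (1 + sqrt 3 * Ci) / 2) * (z - (1 - sqrt 3 * Ci) / 2) = 0).
  { rewrite <- H.
    replace ((z - (1 + sqrt 3 * Ci) / 2) * (z - (1 - sqrt 3 * Ci) / 2))
      with (z * z - z + (1 - (sqrt 3 * sqrt 3) * (Ci * Ci)) / 4) by field.
    rewrite S3, I2. field. }
  revert P. apply Cmult_neq_0.
  - intros K. apply h1. exact (proj2 (Ceq_minus _ _) K).
  - intros K. apply h2. exact (proj2 (Ceq_minus _ _) K).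
Qed.

(** Since z^3 + 1 = (z + 1)(z^2 - z + 1), the factor z + 1 cancels away from -1, and both branches
    share one closed form. *)
Lemma last_term_eq (z : C) :
  z <> 0 -> z * z - z + 1 <> 0 -> last_term z = z / (z * z - z + 1).
Proof.
  intros hz hw. unfold last_term. destruct (Ceq_dec z (- (1))) as [e|n].
  - field. auto.
  - assert (z + 1 <> 0).
    { intros K. apply n. replace z with (z + 1 - 1) by ring. rewrite K. ring. }
    field. repeat split; auto.
    replace (z ^ 3 + 1) with ((z + 1) * (z * z - z + 1)) by ring.
    apply Cmult_neq_0; auto.
Qed.

(** With w = z + 1/z, the prefactor is 1/(w - 1). For y = q^{N+1} the induction step comes down to
    (1 - z^2 y)(1 - y/z^2) - (1 + zy)(1 + y/z) = -(w + 2)(w - 1) y, together with (1 + z)(1 + 1/z) =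
    w + 2. *)
Lemma sum_n_telescoped (q z : C) (N : nat) :
  z <> 0 -> z * z - z + 1 <> 0 ->
  (forall n, qPoch (- z * q) q n <> 0) -> (forall n, qPoch (- / z * q) q n <> 0) ->
  sum_n (fun n => (qPoch (z ^ 2) q n * qPoch (/ z ^ 2) q n * q ^ n)
           / (qPoch (- z * q) q n * qPoch (- / z * q) q n)) N
  = z / (z * z - z + 1)
    * (1 - (1 - z) * (1 - / z)
           * ((qPoch (/ z ^ 2 * q) q N * qPoch (z ^ 2 * q) q N)
              * / (qPoch (- / z * q) q N * qPoch (- z * q) q N))).
Proof.
  intros hz hw hD1 hD2.
  induction N as [|N IH].
  - rewrite sum_O. simpl. field. auto.
  - rewrite sum_Sn, IH. change plus with Cplus.
    (* Removing the first factor of the summand's numerators expresses everything through the same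
       four products, leaving a rational identity. *)
    assert (Hhead : forall A, qPoch A q (S N) = (1 - A) * qPoch (A * q) q N).
    { intros A. change (S N) with (1 + N)%nat. rewrite qPoch_add, Cpow_1_r.
      simpl. ring. }
    rewrite (Hhead (z ^ 2)), (Hhead (/ z ^ 2)).
    assert (h1 := hD1 (S N)). assert (h2 := hD2 (S N)).
    specialize (hD1 N). specialize (hD2 N).
    simpl qPoch in *. rewrite (Cpow_S q N).
    set (a := qPoch (z ^ 2 * q) q N) in *. set (b := qPoch (/ z ^ 2 * q) q N) in *.
    set (d := qPoch (- z * q) q N) in *. set (e := qPoch (- / z * q) q N) in *.
    set (x := q ^ N) in *.
    assert (g1 : 1 - - z * q * x <> 0).
    { intros K. apply h1. rewrite K. ring. }
    (* This is z times the last factor of the second denominator, in the shape [field] asks for. *)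
    assert (g2 : z - -1 * q * x <> 0).
    { intros K. apply h2. replace (1 - - / z * q * x) with ((z - -1 * q * x) / z) by (field; auto).
      rewrite K. field. auto. }
    clearbody a b d e x. clear h1 h2 Hhead IH.
    match goal with |- ?s = ?t => change (@eq C s t) end.
    field. repeat split; auto.
Qed.

Theorem theorem1p1 (q z : C)
  (hq : (Cmod q < 1)%R)
  (hz0 : z <> 0)
  (hz1 : z <> Cexp (PI * Ci / 3))
  (hz2 : z <> Cexp (- (PI * Ci / 3)))
  (hzq : forall j : Z, j <> 0%Z -> z <> - Cpowz q j) :
  is_series
    (fun n : nat =>
       (qPoch (z ^ 2) q n * qPoch (/ z ^ 2) q n * q ^ n)
       / (qPoch (- z * q) q n * qPoch (- / z * q) q n))
    ((1 - z) * (1 - / z)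
       * (- (1) / (z * (1 - / z + / z ^ 2))
          * ((qPoch_inf (/ z ^ 2 * q) q * qPoch_inf (z ^ 2 * q) q)
             / (qPoch_inf (- / z * q) q * qPoch_inf (- z * q) q)))
     + last_term z).
Proof.
  assert (hw := quadratic_neq_0 z hz1 hz2).
  (* A zero factor would give z = -q^{-(k+1)}, excluded by j = -(k+1). The case q = 0 cannot
     interfere, as z q^{k+1} = -1 forces q^{k+1} to be nonzero. *)
  assert (f1 : forall k, 1 - - z * q * q ^ k <> 0).
  { intros k K.
    assert (K' : z * q ^ S k = - (1)).
    { rewrite Cpow_S. replace (z * (q * q ^ k)) with ((1 - - z * q * q ^ k) - 1) by ring.
      rewrite K. ring. }
    assert (Hnz : q ^ S k <> 0).
    { intros E. apply C1_nz. replace (RtoC 1) with (- (- (1))) by ring.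
      rewrite <- K', E. ring. }
    apply (hzq (Z.neg (Pos.of_succ_nat k))); [discriminate|].
    unfold Cpowz. rewrite SuccNat2Pos.id_succ.
    replace z with (z * q ^ S k * / q ^ S k) by (field; exact Hnz).
    rewrite K'. field. exact Hnz. }
  (* Here a zero factor would give z = -q^{k+1}, excluded by j = k+1. *)
  assert (f2 : forall k, 1 - - / z * q * q ^ k <> 0).
  { intros k K.
    apply (hzq (Z.pos (Pos.of_succ_nat k))); [discriminate|].
    unfold Cpowz. rewrite SuccNat2Pos.id_succ, Cpow_S.
    replace z with (z * (1 - - / z * q * q ^ k) - q * q ^ k) at 1 by (field; exact hz0).
    rewrite K. ring. }
  assert (hD1 : forall n, qPoch (- z * q) q n <> 0) by (intros; apply qPoch_neq_0, f1).
  assert (hD2 : forall n, qPoch (- / z * q) q n <> 0) by (intros; apply qPoch_neq_0, f2).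
  assert (hI1 := qPoch_inf_neq_0 _ _ hq f1).
  assert (hI2 := qPoch_inf_neq_0 _ _ hq f2).
  rewrite last_term_eq by assumption.
  set (P := (qPoch_inf (/ z ^ 2 * q) q * qPoch_inf (z ^ 2 * q) q)
            / (qPoch_inf (- / z * q) q * qPoch_inf (- z * q) q)).
  (* As z(1 - 1/z + 1/z^2) = (z^2 - z + 1)/z, the claimed value takes the form of the partial sums,
     with [P] in place of the finite quotient. *)
  replace ((1 - z) * (1 - / z) * (- (1) / (z * (1 - / z + / z ^ 2)) * P)
           + z / (z * z - z + 1))
    with (z / (z * z - z + 1) + - (z / (z * z - z + 1) * ((1 - z) * (1 - / z))) * P)
    by (field; auto).
  unfold is_series.
  apply filterlim_ext with
    (fun N => z / (z * z - z + 1) + - (z / (z * z - z + 1) * ((1 - z) * (1 - / z)))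
       * ((qPoch (/ z ^ 2 * q) q N * qPoch (z ^ 2 * q) q N)
          * / (qPoch (- / z * q) q N * qPoch (- z * q) q N))).
  { intros N. refine (eq_trans _ (eq_sym (sum_n_telescoped q z N hz0 hw hD1 hD2))).
    match goal with |- ?s = ?t => change (@eq C s t) end. ring. }
  apply filterlim_Cplus; [apply filterlim_const|].
  apply filterlim_Cmult; [apply filterlim_const|].
  apply filterlim_Cmult.
  - apply filterlim_Cmult; apply qPoch_inf_lim, hq.
  - apply filterlim_Cinv.
    + apply Cmult_neq_0; assumption.
    + intros n. apply Cmult_neq_0; auto.
    + apply filterlim_Cmult; apply qPoch_inf_lim, hq.
Qed.
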